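(* Let $\overline{A_0A_1A_2A_3}$ be a tetrahedron in $\mathbb{A}^3$ with $B$-quadrances $Q_{ij}$ for $0\le i<j\le 3$ (all nonzero), $B$-quadrume $\mathcal{V}$ and $B$-solid spreads $\mathcal{S}_0,\mathcal{S}_1,\mathcal{S}_2,\mathcal{S}_3$. Then $$\frac{\mathcal{S}_0\mathcal{S}_1\mathcal{S}_2}{Q_{03}Q_{13}Q_{23}}=\frac{\mathcal{S}_0\mathcal{S}_1\mathcal{S}_3}{Q_{02}Q_{12}Q_{23}}=\frac{\mathcal{S}_0\mathcal{S}_2\mathcal{S}_3}{Q_{01}Q_{12}Q_{13}}=\frac{\mathcal{S}_1\mathcal{S}_2\mathcal{S}_3}{Q_{01}Q_{02}Q_{03}}=\frac{\mathcal{V}^3}{64Q_{01}^2Q_{02}^2Q_{03}^2Q_{12}^2Q_{13}^2Q_{23}^2}.$$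
   Context: Let $\mathbb{F}$ be a field of characteristic not $2$, $\mathbb{V}^3=\mathbb{F}^3$ the space of row vectors, and $\mathbb{A}^3$ the three-dimensional affine space over $\mathbb{F}$ with associated vector space $\mathbb{V}^3$; $\overrightarrow{XY}=Y-X$ for points $X,Y$. Let $B$ be a symmetric invertible $3\times3$ matrix over $\mathbb{F}$. Define $v\cdot_B w=vBw^T$, $Q_B(v)=v\cdot_B v$, $v\times_B w=(v\times w)\,\mathrm{adj}\,B$ where $\times$ is the usual cross product and $\mathrm{adj}\,B=(\det B)B^{-1}$, and $[v_1,v_2,v_3]_B=v_1\cdot_B(v_2\times_B v_3)$. A tetrahedron $\overline{A_0A_1A_2A_3}$ is a collection of four points of $\mathbb{A}^3$. Its $B$-quadrances are $Q_{ij}=Q_B(\overrightarrow{A_iA_j})$ (symmetric in $i,j$). Its $B$-quadrume is $\mathcal{V}=\frac{4}{\det B}[\overrightarrow{A_0A_1},\overrightarrow{A_0A_2},\overrightarrow{A_0A_3}]_B^2$. The $B$-solid spread of three concurrent lines with direction vectors $u_1,u_2,u_3$ satisfying $Q_B(u_i)\ne0$ is $\frac{([u_1,u_2,u_3]_B)^2}{(\det B)Q_B(u_1)Q_B(u_2)Q_B(u_3)}$. For $\{i,j,k,l\}=\{0,1,2,3\}$, $\mathcal{S}_i$ is the $B$-solid spread of the lines $A_iA_j$, $A_iA_k$, $A_iA_l$. *)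

(* Defs.v *)
From mathcomp Require Import all_boot all_algebra ring.

Set Implicit Arguments.
Unset Strict Implicit.
Unset Printing Implicit Defensive.

Import GRing.Theory.
Local Open Scope ring_scope.

(* Points of the affine space A^3 over F are modelled by their coordinate     *)
(* rows in 'rV[F]_3, so the vector from X to Y is the difference Y - X.       *)
Definition vec (F : fieldType) (X Y : 'rV[F]_3) : 'rV[F]_3 := Y - X.

Definition dotB (F : fieldType) (B : 'M[F]_3) (v w : 'rV[F]_3) : F :=
  (v *m B *m w^T) 0 0.

Definition quadB (F : fieldType) (B : 'M[F]_3) (v : 'rV[F]_3) : F :=
  dotB B v v.

Definition cross (F : fieldType) (v w : 'rV[F]_3) : 'rV[F]_3 :=
  \row_(k < 3) [:: v 0 1 * w 0 2 - v 0 2 * w 0 1;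
                   v 0 2 * w 0 0 - v 0 0 * w 0 2;
                   v 0 0 * w 0 1 - v 0 1 * w 0 0]`_k.

Definition crossB (F : fieldType) (B : 'M[F]_3) (v w : 'rV[F]_3) : 'rV[F]_3 :=
  cross v w *m \adj B.

Definition tripleB (F : fieldType) (B : 'M[F]_3) (v1 v2 v3 : 'rV[F]_3) : F :=
  dotB B v1 (crossB B v2 v3).

(* Depends only on the lines spanned by the u_i; meaningful when every        *)
(* quadB B u_i is nonzero.                                                    *)
Definition solid_spread (F : fieldType) (B : 'M[F]_3)
    (u1 u2 u3 : 'rV[F]_3) : F :=
  tripleB B u1 u2 u3 ^+ 2
    / (\det B * quadB B u1 * quadB B u2 * quadB B u3).

Definition quadrance (F : fieldType) (B : 'M[F]_3)
    (A : 'I_4 -> 'rV[F]_3) (i j : 'I_4) : F :=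
  quadB B (vec (A i) (A j)).

Definition quadrume (F : fieldType) (B : 'M[F]_3)
    (A : 'I_4 -> 'rV[F]_3) : F :=
  4 / \det B
    * tripleB B (vec (A 0) (A 1)) (vec (A 0) (A 2)) (vec (A 0) (A 3)) ^+ 2.

(* lift i 0, lift i 1, lift i 2 list the three indices other than i in        *)
(* increasing order; vertex_solid_spreadE shows the order is irrelevant.      *)
Definition vertex_solid_spread (F : fieldType) (B : 'M[F]_3)
    (A : 'I_4 -> 'rV[F]_3) (i : 'I_4) : F :=
  solid_spread B (vec (A i) (A (lift i (0 : 'I_3))))
                 (vec (A i) (A (lift i (1 : 'I_3))))
                 (vec (A i) (A (lift i (2 : 'I_3)))).

Lemma tripleBE (F : fieldType) (B : 'M[F]_3) (u v w : 'rV[F]_3) :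
  B^T = B ->
  tripleB B u v w = \det B * (u 0 0 * (v 0 1 * w 0 2 - v 0 2 * w 0 1)
                              + u 0 1 * (v 0 2 * w 0 0 - v 0 0 * w 0 2)
                              + u 0 2 * (v 0 0 * w 0 1 - v 0 1 * w 0 0)).
Proof.
move=> symB; rewrite /tripleB /dotB /crossB trmx_mul trmx_adj symB.
rewrite mulmxA -(mulmxA u) mul_mx_adj mul_mx_scalar -scalemxAl mxE.
have e1 : lift ord0 (ord0 : 'I_2) = 1 :> 'I_3 by apply: val_inj.
have e2 : lift ord0 (lift ord0 (ord0 : 'I_1)) = 2 :> 'I_3 by apply: val_inj.
congr (_ * _); rewrite mxE !big_ord_recl big_ord0 e1 e2 !mxE /=.
by rewrite addr0 addrA.
Qed.

Lemma solid_spreadC12 (F : fieldType) (B : 'M[F]_3) (u v w : 'rV[F]_3) :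
  B^T = B -> solid_spread B u v w = solid_spread B v u w.
Proof.
move=> symB; rewrite /solid_spread !tripleBE //.
by congr (_ / _); ring.
Qed.

Lemma solid_spreadC23 (F : fieldType) (B : 'M[F]_3) (u v w : 'rV[F]_3) :
  B^T = B -> solid_spread B u v w = solid_spread B u w v.
Proof.
move=> symB; rewrite /solid_spread !tripleBE //.
by congr (_ / _); ring.
Qed.

Lemma vertex_solid_spreadE (F : fieldType) (B : 'M[F]_3)
    (A : 'I_4 -> 'rV[F]_3) (i j k l : 'I_4) :
  B^T = B -> uniq [:: i; j; k; l] ->
  vertex_solid_spread B A i =
  solid_spread B (vec (A i) (A j)) (vec (A i) (A k)) (vec (A i) (A l)).
Proof.
move=> symB; rewrite /= !inE !negb_or => /and4P[/and3P[ij ik il] /andP[jk jl] kl _].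
have C12 u v w := @solid_spreadC12 F B u v w symB.
have C23 u v w := @solid_spreadC23 F B u v w symB.
have [j' ej|ej] := unliftP i j; last by rewrite ej eqxx in ij.
have [k' ek|ek] := unliftP i k; last by rewrite ek eqxx in ik.
have [l' el|el] := unliftP i l; last by rewrite el eqxx in il.
move: jl kl jk; rewrite ej ek el !(inj_eq lift_inj) /vertex_solid_spread.
have ord3 (m : 'I_3) : [\/ m = 0, m = 1 | m = 2].
  by case: m => [[|[|[|//]]] ltm]; [apply: Or31|apply: Or32|apply: Or33];
     apply: val_inj.
case: (ord3 j') (ord3 k') (ord3 l') => -> [] -> [] -> //= _ _ _.
- by rewrite C12 C23.
- by rewrite C23 C12.
- by rewrite C12 C23 C12.
Qed.

(* Main.v *)
Require Import Defs.
From mathcomp Require Import all_boot all_algebra.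
From mathcomp Require Import ring.
Import GRing.Theory.
Local Open Scope ring_scope.

(** Every solid spread of a tetrahedron is the quadrume normalised by the
    quadrances of the three edges at the vertex,
    S_i = V / (4 * \prod_(j != i) Q_ij),
    because the triple product of the edge vectors issuing from a vertex, a
    signed volume up to a constant factor, is up to sign the same for all four
    vertices.  This is [vertex_solid_spread_quadrume].  In a product of
    three solid spreads S_i S_j S_k, each of the three edges within the face
    ijk is met twice and each of the three edges to the remaining vertex l is
    met once.  Dividing by Q_il Q_jl Q_kl therefore squares all six quadrances,
    and what is left is the expression (V / 4)^3 / \prod Q^2, which no longer
    depends on the choice of the three vertices. *)

Lemma exp2_neq0 (F : fieldType) (k : nat) :
  2%N \notin [pchar F] -> ((2 ^ k)%:R : F) != 0.
Proof.
move=> charF; rewrite natrX; apply: expf_neq0.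
by apply: contra charF => /eqP/eqP; rewrite inE.
Qed.

Lemma quadranceC (F : fieldType) (B : 'M[F]_3) (A : 'I_4 -> 'rV[F]_3)
    (i j : 'I_4) :
  quadrance B A i j = quadrance B A j i.
Proof.
rewrite /quadrance /quadB /dotB /vec -(opprB (A i)) linearN /=.
by rewrite !mulNmx mulmxN opprK.
Qed.

(** The triple product at a vertex is \det B times the determinant of the edge
    vectors. Moving the origin to another vertex is a translation, and it lists
    the vertices in another order, so only the sign of that determinant can
    change; the square removes it. *)
Lemma vertex_tripleB_sqr (F : fieldType) (B : 'M[F]_3) (A : 'I_4 -> 'rV[F]_3)
    (i : 'I_4) :
  B^T = B ->
  tripleB B (vec (A i) (A (lift i (0 : 'I_3))))
            (vec (A i) (A (lift i (1 : 'I_3))))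
            (vec (A i) (A (lift i (2 : 'I_3)))) ^+ 2
  = tripleB B (vec (A 0) (A 1)) (vec (A 0) (A 2)) (vec (A 0) (A 3)) ^+ 2.
Proof.
move=> symB.
have liftE (j k : 'I_4) (m : 'I_3) : bump j m = k -> lift j m = k.
  by move=> e; apply: val_inj.
have [-> | -> | -> | ->] : [\/ i = 0, i = 1, i = 2 | i = 3].
  by case: i => [[|[|[|[|//]]]] lti];
    [apply: Or41 | apply: Or42 | apply: Or43 | apply: Or44]; apply: val_inj.
- by rewrite (liftE 0 1) // (liftE 0 2) // (liftE 0 3).
- rewrite (liftE 1 0) // (liftE 1 2) // (liftE 1 3) // !tripleBE // /vec !mxE.
  by ring.
- rewrite (liftE 2 0) // (liftE 2 1) // (liftE 2 3) // !tripleBE // /vec !mxE.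
  by ring.
- rewrite (liftE 3 0) // (liftE 3 1) // (liftE 3 2) // !tripleBE // /vec !mxE.
  by ring.
Qed.

(** The factor 4 in the quadrume cancels against the one in the denominator;
    this is where characteristic 2 has to be excluded. *)
Lemma vertex_solid_spread_quadrume (F : fieldType) (B : 'M[F]_3)
    (A : 'I_4 -> 'rV[F]_3) (i : 'I_4) :
  2%N \notin [pchar F] -> B^T = B ->
  vertex_solid_spread B A i =
  quadrume B A / (4 * \prod_(j < 4 | j != i) quadrance B A i j).
Proof.
move=> charF symB.
have nz4 : (4 : F) != 0 by exact: (exp2_neq0 _ 2).
have -> : \prod_(j < 4 | j != i) quadrance B A i j
          = \prod_(m < 3) quadrance B A i (lift i m).
  rewrite (reindex_omap (lift i) (unlift i)) /=; last first.
    by move=> j; rewrite eq_sym => /unlift_some[m -> ->].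
  by apply: eq_bigl => m; rewrite liftK eqxx eq_sym neq_lift.
rewrite !big_ord_recl big_ord0 mulr1 /quadrume -(vertex_tripleB_sqr _ B A i symB).
have -> : lift ord0 (ord0 : 'I_2) = 1 :> 'I_3 by apply: val_inj.
have -> : lift ord0 (lift ord0 (ord0 : 'I_1)) = 2 :> 'I_3 by apply: val_inj.
rewrite /vertex_solid_spread /solid_spread -!/(quadrance B A i _).
(* Naming the inverses keeps [field] from asking for nonzero quadrances. *)
rewrite !invfM; set d := (\det B)^-1; set t := _ ^+ 2.
set x := (quadrance _ _ _ (lift i 0))^-1.
set y := (quadrance _ _ _ _)^-1; set z := (quadrance _ _ _ _)^-1.
by field.
Qed.

Theorem theorem21 (F : fieldType) (charF : 2%N \notin [pchar F])
    (B : 'M[F]_3) (symB : B^T = B) (invB : B \in unitmx)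
    (A : 'I_4 -> 'rV[F]_3)
    (nzQ : forall i j : 'I_4, (i < j)%N -> quadrance B A i j != 0) :
  let Q := quadrance B A in
  let S := vertex_solid_spread B A in
  let V := quadrume B A in
  [/\ S 0 * S 1 * S 2 / (Q 0 3 * Q 1 3 * Q 2 3)
        = S 0 * S 1 * S 3 / (Q 0 2 * Q 1 2 * Q 2 3),
      S 0 * S 1 * S 3 / (Q 0 2 * Q 1 2 * Q 2 3)
        = S 0 * S 2 * S 3 / (Q 0 1 * Q 1 2 * Q 1 3),
      S 0 * S 2 * S 3 / (Q 0 1 * Q 1 2 * Q 1 3)
        = S 1 * S 2 * S 3 / (Q 0 1 * Q 0 2 * Q 0 3)
    & S 1 * S 2 * S 3 / (Q 0 1 * Q 0 2 * Q 0 3)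
        = V ^+ 3 / (64 * Q 0 1 ^+ 2 * Q 0 2 ^+ 2 * Q 0 3 ^+ 2
                       * Q 1 2 ^+ 2 * Q 1 3 ^+ 2 * Q 2 3 ^+ 2)].
Proof.
move=> Q S V.
have QC i j : Q i j = Q j i by exact: quadranceC.
have SE i : S i = V / (4 * \prod_(j < 4 | j != i) Q i j).
  exact: vertex_solid_spread_quadrume.
have prod4 (f : 'I_4 -> F) (i : 'I_4) : \prod_(j < 4 | j != i) f j
    = (if 0 != i then f 0 else 1) * (if 1 != i then f 1 else 1)
      * (if 2 != i then f 2 else 1) * (if 3 != i then f 3 else 1).
  have e1 : lift ord0 (ord0 : 'I_3) = 1 :> 'I_4 by apply: val_inj.
  have e2 : lift ord0 (lift ord0 (ord0 : 'I_2)) = 2 :> 'I_4 by apply: val_inj.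
  have e3 : lift ord0 (lift ord0 (lift ord0 (ord0 : 'I_1))) = 3 :> 'I_4.
    by apply: val_inj.
  by rewrite big_mkcond !big_ord_recl big_ord0 e1 e2 e3 /= mulr1 !mulrA.
rewrite !SE !prod4 /= !mul1r !mulr1.
(* Each edge occurs at both of its ends; orient it from the smaller index. *)
rewrite (QC 1 0) (QC 2 0) (QC 3 0) (QC 2 1) (QC 3 1) (QC 3 2).
have nz01 : Q 0 1 != 0 by exact: nzQ.
have nz02 : Q 0 2 != 0 by exact: nzQ.
have nz03 : Q 0 3 != 0 by exact: nzQ.
have nz12 : Q 1 2 != 0 by exact: nzQ.
have nz13 : Q 1 3 != 0 by exact: nzQ.
have nz23 : Q 2 3 != 0 by exact: nzQ.
have nz4 : (4 : F) != 0 by exact: (exp2_neq0 _ 2).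
have nz64 : (64 : F) != 0 by exact: (exp2_neq0 _ 6).
by split; field; rewrite ?nz64 nz4 nz01 nz02 nz03 nz12 nz13 nz23.
Qed.
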